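(* Let $x=(u,z)\in V$ be the solution of the reduced and rescaled optimality system $$b_\alpha(x,\varphi)=\langle f,\varphi_2\rangle_2-\tfrac1{\sqrt\alpha}(u_d,I\varphi_1)_W\qquad\text{for all }\varphi=(\varphi_1,\varphi_2)\in V ,$$ and let $\tilde x=(\tilde u,\tilde z)$ with $\tilde u\in V_1$ (some approximate state) and $\tilde z\in V_2$ (some approximate rescaled adjoint state) be arbitrary. Then $$\frac1{M_a}\,\|\operatorname{Res}(\tilde x)\|_*\;\le\; d_\alpha(x,\tilde x)\;\le\;\frac{\kappa}{m_a}\,\|\operatorname{Res}(\tilde x)\|_* .$$
   Context: Let $V_1,V_2,Q,W$ be real Hilbert spaces with scalar products $(\cdot,\cdot)_1,(\cdot,\cdot)_2,(\cdot,\cdot)_Q,(\cdot,\cdot)_W$ and induced norms $\|\cdot\|_1,\|\cdot\|_2,\|\cdot\|_Q,\|\cdot\|_W$; $\langle\cdot,\cdot\rangle_i$ is the duality pairing of $V_i^*\times V_i$ and $\|\cdot\|_{i,*}$ the dual norm on $V_i^*$. $A:V_1\to V_2^*$ is a linear isomorphism with associated bilinear form $a(v_1,v_2)=\langle Av_1,v_2\rangle_2$ on $V_1\times V_2$, that is: $M_a:=\sup_{\|v_1\|_1=1}\sup_{\|v_2\|_2=1}a(v_1,v_2)<\infty$; if $v_1\in V_1$ satisfies $a(v_1,v_2)=0$ for all $v_2\in V_2$ then $v_1=0$; and $m_a:=\inf_{\|v_2\|_2=1}\sup_{\|v_1\|_1=1}a(v_1,v_2)>0$. $C:Q\to V_2^*$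 is linear and bounded with constant $M_C$, $I:V_1\to W$ is linear and bounded with constant $M_I$, and $M:=\max\{M_I,M_C\}$. Further $f\in V_2^*$, $u_d\in W$, $\alpha>0$, and $K\subset Q$ is nonempty, closed and convex with metric projection $\Pi_K:Q\to K$. Adjoints are defined by $A^*v_2=a(\cdot,v_2)$, $(q,C^*v_2)_Q=\langle Cq,v_2\rangle_2$, $\langle I^*w,v_1\rangle_1=(Iv_1,w)_W$. $V:=V_1\times V_2$ with $\|v\|:=(\|v_1\|_1^2+\|v_2\|_2^2)^{1/2}$ for $v=(v_1,v_2)$, and $\|\cdot\|_*$ is the induced dual norm on $V^*=V_1^*\times V_2^*$. For $v,\varphi\in V$, $$b_\alpha(v,\varphi):=a(v_1,\varphi_2)+a(\varphi_1,v_2)-\big(\Pi_K(-\tfrac1{\sqrt\alpha}C^*v_2),C^*\varphi_2\big)_Q-\tfrac1{\sqrt\alpha}(Iv_1,I\varphi_1)_W .$$ The optimality system has a unique solution; it characterizes (with control $q=\Pi_K(-\tfrac{1}{\sqrt\alpha}C^*z)$) the minimizer of $\frac12\|Iu-u_d\|_W^2+\frac\alpha2\|q\|_Q^2$ over $(q,u)\in K\times V_1$ subject to $Au=f+Cq$. The residual $\operatorname{Res}(\tilde x)\in V^*$ is $$\langle\operatorname{Res}(\tilde x),\varphi\rangle=\big\langle f-A\tilde u+C\Pi_K(-\tfrac1{\sqrt\alpha}C^*\tilde z),\varphi_2\big\rangle_2+\big\langle\tfrac1{\sqrt\alpha}I^*(I\tilde u-u_d)-A^*\tilde z,\varphi_1\big\rangle_1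 .$$ For $v,w\in V$, $$\delta_\alpha(v,w)^2:=\alpha\big\|\Pi_K(-\tfrac1{\sqrt\alpha}C^*v_2)-\Pi_K(-\tfrac1{\sqrt\alpha}C^*w_2)\big\|_Q^2+\|I(v_1-w_1)\|_W^2,$$ $$d_\alpha(v,w):=\|v-w\|+\tfrac1{\sqrt\alpha}\tfrac{M}{M_a}\,\delta_\alpha(v,w).$$ Finally $$\kappa:=\frac{1+2L}{1+L}\Big(1+\frac{M}{m_a}(1+2L)\Big),\qquad L:=\frac{M}{\sqrt\alpha}.$$ *)

(* Defs.v *)
From HB Require Import structures.
From mathcomp Require Import all_boot all_order all_algebra.
From mathcomp Require Import sesquilinear.
From mathcomp Require Import all_classical all_reals all_analysis.

Set Implicit Arguments.
Unset Strict Implicit.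
Unset Printing Implicit Defensive.

Import Order.TTheory GRing.Theory Num.Theory.
Import numFieldNormedType.Exports.

Local Open Scope classical_set_scope.
Local Open Scope ring_scope.

(* Real Hilbert spaces: complete normed spaces whose norm is induced by a
   symmetric positive definite bilinear form. *)
HB.mixin Record CompleteNormedModule_isHilbert (R : realType) V
    of CompleteNormedModule R V := {
  inner : {dot V for (@idfun R)} ;
  sqr_normE : forall v : V, `|v| ^+ 2 = inner v v
}.

#[short(type="hilbertType")]
HB.structure Definition Hilbert (R : realType) :=
  {V of CompleteNormedModule_isHilbert R V & CompleteNormedModule R V}.

Notation "''(' u , v ')'" := (inner u v)
  (at level 0, u at level 99, v at level 99, format "''(' u ,  v ')'")
  : ring_scope.

(* The topological dual V^*, as a subspace of the functions V -> R. *)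
Section Dual.
Context {R : realType}.

Definition is_dual (V : normedModType R) : {pred V -> R} :=
  fun F => `[< scalar F /\ continuous F >].

Lemma is_dual_submod_closed (V : normedModType R) :
  submod_closed (@is_dual V).
Proof.
split=> [|a F G /asboolP[linF cF] /asboolP[linG cG]]; apply/asboolP; split.
- by move=> a u v; rewrite mulr0 addr0.
- exact: cst_continuous.
- move=> b u v; rewrite /= !fctE /= linF linG.
  by rewrite !scalerDr /GRing.scale /= mulrDr mulrCA -!addrA;
     congr (_ + _); rewrite addrCA.
- move=> x; apply: (@continuousD _ R^o V); last exact: cG.
  by apply: (@continuousM R V); [exact: cst_continuous|exact: cF].
Qed.

HB.instance Definition _ (V : normedModType R) :=
  GRing.isSubmodClosed.Build R (V -> R) (@is_dual V) (is_dual_submod_closed V).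

Record dual (V : normedModType R) :=
  Dual { dual_fun :> V -> R ; _ : dual_fun \in @is_dual V }.

HB.instance Definition _ (V : normedModType R) := [isSub for @dual_fun V].
HB.instance Definition _ (V : normedModType R) :=
  [Choice of dual V by <:].
HB.instance Definition _ (V : normedModType R) :=
  [SubChoice_isSubLmodule of dual V by <:].

End Dual.

(* Dual norm on functionals, relative to the norm N; it is taken in the
   extended reals, so that it is meaningful without a boundedness proof. *)
Definition dual_norm {R : realType} {V : Type} (N F : V -> R) : \bar R :=
  ereal_sup [set `|F v|%:E | v in [set v | N v <= 1]].

Section Forms.
Context {R : realType} {V1 V2 : normedModType R}.

(* M_a and m_a for the form a(v1, v2) = <A v1, v2>. *)
Definition form_sup (A : V1 -> dual V2) : \bar R :=
  ereal_sup [set ereal_sup [set (A v1 v2)%:E | v2 in [set v | `|v| = 1]]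
            | v1 in [set v | `|v| = 1]].

Definition form_infsup (A : V1 -> dual V2) : \bar R :=
  ereal_inf [set ereal_sup [set (A v1 v2)%:E | v1 in [set v | `|v| = 1]]
            | v2 in [set v | `|v| = 1]].

(* The library norm of V1 * V2 is the maximum norm, which is not used here. *)
Definition prod_norm (v : V1 * V2) : R :=
  Num.sqrt (`|v.1| ^+ 2 + `|v.2| ^+ 2).

End Forms.

Section OptimalitySystem.
Context {R : realType} {V1 V2 Q W : hilbertType R}.
Variables (A : V1 -> dual V2) (C : Q -> dual V2) (I : V1 -> W).
Variables (K : set Q) (alpha : R).

(* The element of K nearest to q: it exists and is unique when K is nonempty,
   closed and convex. *)
Definition metric_proj (q : Q) : Q :=
  xget 0 [set p | K p /\ forall r, K r -> `|q - p| <= `|q - r|].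

Definition adjA (v2 : V2) : V1 -> R := fun v1 => A v1 v2.

(* The Riesz representative of q |-> <C q, v2>. *)
Definition adjC (v2 : V2) : Q := xget 0 [set p | forall q, '(q, p) = C q v2].

Definition adjI (w : W) : V1 -> R := fun v1 => '(I v1, w).

Definition control (v2 : V2) : Q :=
  metric_proj (- (Num.sqrt alpha)^-1 *: adjC v2).

Definition b_alpha (v phi : V1 * V2) : R :=
  A v.1 phi.2 + A phi.1 v.2 - '(control v.2, adjC phi.2)
  - (Num.sqrt alpha)^-1 * '(I v.1, I phi.1).

Definition residual (f : dual V2) (u_d : W) (x phi : V1 * V2) : R :=
  (f - A x.1 + C (control x.2)) phi.2
  + ((Num.sqrt alpha)^-1 *: adjI (I x.1 - u_d) - adjA x.2) phi.1.

Definition delta_alpha (v w : V1 * V2) : R :=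
  Num.sqrt (alpha * `|control v.2 - control w.2| ^+ 2
            + `|I (v.1 - w.1)| ^+ 2).

Definition d_alpha (M Ma : R) (v w : V1 * V2) : R :=
  prod_norm (v - w) + (Num.sqrt alpha)^-1 * (M / Ma) * delta_alpha v w.

End OptimalitySystem.

Definition kappa {R : realType} (M ma alpha : R) : R :=
  let L := M / Num.sqrt alpha in
  (1 + 2 * L) / (1 + L) * (1 + M / ma * (1 + 2 * L)).

(* Main.v *)
(** Write [e = x - xt], [s = alpha^(-1/2)] and
    [D = s * delta_alpha x xt], and let [r] be the dual norm of the residual.
    Subtracting the equations, [Res phi] equals
    [A e.1 phi.2 + A phi.1 e.2 - C dq phi.2 - s '(I e.1, I phi.1)] with [dq]
    the difference of the controls, which gives
    [r <= Ma * prod_norm e + M * D].  Conversely, the inf-sup condition, and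
    its transpose, which follows from the injectivity of [A] and the closed
    range of its adjoint, give [ma * prod_norm e <= r + M * D].  Testing with
    [(e.1, - e.2)] cancels the [A] terms, and since the metric projection is
    monotone this yields [D ^+ 2 <= s * r * prod_norm e].  The two inequalities
    combine into a quadratic inequality for [M * D / r], whose solutions are
    controlled by [kappa]. *)
From HB Require Import structures.
Require Import Defs.
From mathcomp Require Import all_boot all_order all_algebra.
From mathcomp Require Import sesquilinear ring lra.
From mathcomp Require Import all_classical all_reals all_analysis.

Set Implicit Arguments.
Unset Strict Implicit.
Unset Printing Implicit Defensive.

Import Order.TTheory GRing.Theory Num.Theory.
Import numFieldNormedType.Exports.

Local Open Scope classical_set_scope.
Local Open Scope ring_scope.

(** * Projections in Hilbert spaces *)

Section Hilbert.
Context {R : realType} {V : hilbertType R}.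
Implicit Types (u v w : V) (a : R).

Lemma innerC u v : '(u, v) = '(v, u).
Proof. by rewrite hermC /= expr0 mul1r. Qed.

Lemma innerDl u v w : '(u + v, w) = '(u, w) + '(v, w).
Proof. exact: linearDl. Qed.

Lemma innerZl a u w : '(a *: u, w) = a * '(u, w).
Proof. exact: linearZl_LR. Qed.

Lemma innerDr u v w : '(u, v + w) = '(u, v) + '(u, w).
Proof. exact: linearDr. Qed.

Lemma innerZr a u w : '(u, a *: w) = a * '(u, w).
Proof. by rewrite innerC innerZl innerC. Qed.

Lemma innerNl u w : '(- u, w) = - '(u, w).
Proof. by rewrite -scaleN1r innerZl mulN1r. Qed.

Lemma innerNr u w : '(u, - w) = - '(u, w).
Proof. by rewrite -scaleN1r innerZr mulN1r. Qed.

Definition innerE :=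
  (innerDl, innerDr, innerZl, innerZr, innerNl, innerNr).

Lemma inner_inj u v : (forall w, '(w, u) = '(w, v)) -> u = v.
Proof.
move=> h; apply/eqP; rewrite -subr_eq0 -normr_eq0 -sqrf_eq0 sqr_normE.
by rewrite innerDr innerNr h subrr.
Qed.

Lemma cauchy_schwarz u v : `|'(u, v)| <= `|u| * `|v|.
Proof.
have h : '(u, v) ^+ 2 <= `|u| ^+ 2 * `|v| ^+ 2.
  have [->|v0] := eqVneq v 0.
    by rewrite -(scale0r 0) innerZr mul0r expr0n /= mulr_ge0 ?sqr_ge0.
  (* This square expands to ['(v, v)] times the difference of the two sides of the claim. *)
  have := sqr_ge0 `|'(v, v) *: u - '(u, v) *: v|.
  rewrite [in X in X -> _]sqr_normE !innerE (innerC v u) !sqr_normE.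
  have : 0 < '(v, v) by rewrite -sqr_normE exprn_gt0 // normr_gt0.
  set b := '(u, v); set n := '(v, v) => n0 h.
  by rewrite -(ler_pM2l n0) -subr_ge0; apply: le_trans h _; lra.
by rewrite -ler_sqr ?nnegrE ?mulr_ge0 // exprMn -normrX ger0_norm ?sqr_ge0.
Qed.

(* The derivative at [t = 0] of the squared distance from [g] to
   [p + t (k - p)] is [- 2 '(g - p, k - p)]. *)
Lemma minimizer_variational_ineq (g p k : V) :
  (forall t, 0 <= t <= 1 -> `|g - p| <= `|g - (p + t *: (k - p))|) ->
  '(g - p, k - p) <= 0.
Proof.
move=> h; rewrite leNgt; apply/negP => B0.
set B := '(_, _) in B0; set n := `|k - p| ^+ 2.
have n0 : 0 <= n by rewrite sqr_ge0.
have Bn : 0 < B + n by lra.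
(* The squared distance changes by [- 2 t B + t ^+ 2 n], with minimum at [B / n]. Adding [B] to the
   denominator keeps [t] in [(0, 1]], also for [n = 0], and the change stays negative. *)
set t := B / (B + n).
have t0 : 0 < t by rewrite divr_gt0.
have t1 : t <= 1 by rewrite ler_pdivrMr // mul1r lerDl.
have tn : t * (B + n) = B by rewrite divfK // gt_eqF.
have := h t; rewrite (ltW t0) t1 => /(_ isT).
rewrite -ler_sqr ?nnegrE // opprD addrA sqr_normE [leRHS]sqr_normE.
rewrite (innerDl (g - p)) !(innerDr _ (g - p)) !innerNl !innerNr !innerZl.
rewrite !innerZr (innerC (k - p)) -/B -(sqr_normE (k - p)) -/n => h2.
have : 2 * t * B <= t * (t * n) by lra.
rewrite -mulrA mulrCA ler_pM2l //.
have : 0 < t * B by rewrite mulr_gt0.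
by move=> ? ?; lra.
Qed.

End Hilbert.

Section Minimizer.
Context {R : realType} {X : completeNormedModType R} {H : hilbertType R}.

(* A minimizing sequence is Cauchy by the parallelogram identity. *)
Lemma exists_minimizer (T : {linear X -> H}) (c : R) (K : set X) (g : H) :
  0 < c -> (forall v, `|v| <= c * `|T v|) -> continuous T ->
  K !=set0 -> closed K ->
  (forall u v, K u -> K v -> K (2^-1 *: (u + v))) ->
  exists2 p, K p & forall k, K k -> `|g - T p| <= `|g - T k|.
Proof.
move=> c0 hc cT [k0 Kk0] Kcl Kconv.
pose D := [set `|g - T k| ^+ 2 | k in K].
have hD : has_inf D.
  by split; [exists (`|g - T k0| ^+ 2), k0|exists 0 => _ [k _ <-]; rewrite sqr_ge0].
pose S e := [set k | K k /\ `|g - T k| ^+ 2 <= inf D + e].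
have Sn0 e : 0 < e -> S e !=set0.
  move=> e0; have [_ [k Kk <-] hk] := inf_adherent e0 hD.
  by exists k; split => //; exact: ltW.
have infle k : K k -> inf D <= `|g - T k| ^+ 2.
  by move=> Kk; apply: ge_inf; [exact: hD.2|exists k].
(* The midpoint of [x] and [y] lies in [K], so its squared distance is at least [inf D]; the
   parallelogram identity leaves [4 * (inf D + e) - 4 * inf D]. *)
have Sdist e x y : S e x -> S e y -> `|T x - T y| ^+ 2 <= 4 * e.
  move=> [Kx hx] [Ky hy]; have := infle _ (Kconv _ _ Kx Ky).
  rewrite linearZ linearD.
  have -> : g - 2^-1 *: (T x + T y) = 2^-1 *: ((g - T x) + (g - T y)).
    rewrite addrACA -opprD scalerBr; congr (_ - _).
    by rewrite -[g + g]mulr2n -[g *+ 2]scaler_nat scalerA mulVf ?scale1r.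
  have -> : T x - T y = (g - T y) - (g - T x).
    by rewrite opprB [RHS]addrC addrA subrK.
  move: hx hy; move: (g - T x) (g - T y) => a b.
  by rewrite !sqr_normE !innerE (innerC b a); lra.
(* The filter of near-minimizers replaces a minimizing sequence, so no choice of points is made. *)
pose F := filter_from [set e : R | 0 < e] S.
have FF : Filter F.
  apply: filter_from_filter; first by exists 1 => /=.
  move=> i j i0 j0; exists (Num.min i j); first by rewrite /= lt_min i0 j0.
  move=> x [Kx hx]; split; split => //; apply: le_trans hx _;
    by rewrite lerD2l ge_min lexx ?orbT.
have PF : ProperFilter F by apply: filter_from_proper => // e /Sn0.
have /cauchy_cvg cvF : cauchy F.
  apply/cauchy_exP => e e0.
  (* With this [d], [Sdist] gives [e / (2 * c)] for the images, and [hc] turns this into [e / 2] for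
     the points of [X]. *)
  pose d := (e / (4 * c)) ^+ 2.
  have d0 : 0 < d by rewrite exprn_gt0 // divr_gt0 // mulr_gt0.
  have [x Sx] := Sn0 _ d0; exists x; exists d => // y Sy.
  rewrite -ball_normE /=; apply: le_lt_trans (hc _) _; rewrite linearB.
  have : `|T x - T y| <= e / (2 * c).
    have ec : 0 < e / (2 * c) by rewrite divr_gt0 // mulr_gt0.
    rewrite -ler_sqr ?nnegrE ?(ltW ec) //.
    apply: le_trans (Sdist _ _ _ Sx Sy) _; rewrite /d le_eqVlt; apply/orP; left.
    by apply/eqP; field; rewrite gt_eqF.
  rewrite -(ler_pM2l c0) => /le_lt_trans; apply.
  have -> : c * (e / (2 * c)) = e / 2 by field; rewrite gt_eqF.
  by lra.
exists (lim F).
  refine (@closed_cvg X X F PF id K Kcl _ (lim F) cvF).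
  by exists 1 => [|v []] /=.
move=> k Kk; rewrite -ler_sqr ?nnegrE //; apply: le_trans (infle _ Kk).
apply/ler_addgt0Pr => e e0.
have cvh : (fun v => `|g - T v| ^+ 2) @ F --> `|g - T (lim F)| ^+ 2.
  rewrite expr2; under eq_fun do rewrite expr2.
  have hn : (fun v => `|g - T v|) @ F --> `|g - T (lim F)|.
    apply: cvg_norm; apply: cvgB; first exact: cvg_cst.
    exact: continuous_cvg (cT _) cvF.
  exact: cvgM.
refine (@closed_cvg X R F PF _ _ (@closed_le _ (inf D + e)) _ _ cvh).
by exists e => [|v []].
Qed.

End Minimizer.

Lemma bounded_linear_is_continuous (R : realType) (V W : normedModType R)
    (T : V -> W) (c : R) :
  linear T -> (forall v, `|T v| <= c * `|v|) -> continuous T.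
Proof.
move=> linT hc.
have TB u v : T u - T v = T (u - v).
  by rewrite -[u in LHS](subrK v) -(scale1r (u - v)) linT !scale1r addrK.
move=> u; apply/cvgrPdist_le => e e0.
(* The bound [c] may be zero or negative; [|c| + 1] is a positive constant to divide by. *)
have c0 : 0 < `|c| + 1 by rewrite ltr_wpDl.
near=> v; rewrite TB; apply: le_trans (hc _) _.
apply: (@le_trans _ _ ((`|c| + 1) * `|u - v|)).
  by rewrite ler_wpM2r // (le_trans (ler_norm c)) // lerDl.
rewrite -ler_pdivlMl //; near: v.
by apply: cvgr_dist_le => //; rewrite mulr_gt0 ?invr_gt0.
Unshelve. all: by end_near. Qed.

Section Projection.
Context {R : realType} {V : hilbertType R}.

(** The case of the identity map in [exists_minimizer]. Closure under midpoints is what kernels of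
    functionals and convex sets both supply. *)
Lemma exists_nearest (K : set V) (g : V) :
  K !=set0 -> closed K ->
  (forall u v, K u -> K v -> K (2^-1 *: (u + v))) ->
  exists2 p, K p & forall k, K k -> `|g - p| <= `|g - k|.
Proof.
move=> K0 Kcl Kmid.
apply: (@exists_minimizer R V V idfun 1) => //.
  by move=> v; rewrite mul1r.
by move=> v; exact: cvg_id.
Qed.

(** If [F g] is nonzero and [p] is the point of the kernel nearest to [g], then [g - p] is
    orthogonal to the kernel, and a multiple of it represents [F]. *)
Lemma riesz (F : V -> R) (c : R) :
  scalar F -> (forall v, `|F v| <= c * `|v|) ->
  exists p, forall q, '(q, p) = F q.
Proof.
move=> linF hc.
have cF : continuous F by apply: (@bounded_linear_is_continuous R V R^o F c).
have F0 : F 0 = 0 by have := linF (-1) 0 0; rewrite scaler0 addr0 mulN1r addNr.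
have FZ a v : F (a *: v) = a * F v by rewrite -[a *: v]addr0 linF F0 addr0.
have FD u v : F (u + v) = F u + F v by rewrite -[u in LHS]scale1r linF mul1r.
have FN u : F (- u) = - F u by rewrite -scaleN1r FZ mulN1r.
have [F_eq0|] := pselect (forall v, F v = 0).
  by exists 0 => q; rewrite F_eq0 -(scale0r 0) innerZr mul0r.
move=> /existsNP[g /eqP Fg].
pose N := [set v | F v = 0].
have Ncl : closed N.
  exact: (proj1 (@continuous_closedP V R F) cF _ (@closed_eq R 0)).
have [||p Np hp] := @exists_nearest N g _ Ncl.
- by exists 0.
- by move=> u v; rewrite /N /= FZ FD => -> ->; rewrite addr0 mulr0.
have orth k : F k = 0 -> '(k, g - p) = 0.
  have half k' : F k' = 0 -> '(g - p, k') <= 0.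
    move=> Fk'; have -> : k' = (p + k') - p by rewrite addrAC subrr add0r.
    apply: minimizer_variational_ineq => t _; apply: hp.
    by rewrite /N /= FD FZ !FD FN Fk' Np !(addr0, oppr0, mulr0).
  move=> Fk; apply/eqP; rewrite innerC eq_le half //= -oppr_le0 -innerNr.
  by rewrite half // FN Fk oppr0.
have Fn : F (g - p) = F g by rewrite FD FN Np oppr0 addr0.
have n0 : `|g - p| != 0.
  rewrite normr_eq0; apply: contra Fg => /eqP gp.
  by rewrite -Fn gp F0.
exists (F g / `|g - p| ^+ 2 *: (g - p)) => q.
(* Since [F (g - p) = F g], the first argument is the component of [q] in the kernel. *)
have : '(q - F q / F g *: (g - p), g - p) = 0.
  by apply: orth; rewrite FD FN FZ Fn divfK // subrr.
rewrite innerDl innerNl innerZl -sqr_normE innerZr => /eqP.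
rewrite subr_eq0 => /eqP ->; field.
by rewrite n0 Fg.
Qed.

End Projection.

(** * Metric projection onto a closed convex set *)

Section MetricProjection.
Context {R : realType} {Q : hilbertType R} (K : set Q).
Hypotheses (K0 : K !=set0) (Kcl : closed K)
  (Kconv : convex_set (K : set (convex_lmodType Q))).

Lemma convex_segment (u v : Q) (t : R) :
  K u -> K v -> 0 <= t <= 1 -> K (u + t *: (v - u)).
Proof.
move=> Ku Kv /andP[t0 t1].
have : K (t *: v + (1 - t) *: u).
  exact: set_mem (Kconv (Itv01 t0 t1) (mem_set Kv) (mem_set Ku)).
by congr K; rewrite scalerBl scale1r scalerBr addrCA.
Qed.

(** A nearest point exists, so [xget] does not fall back on its default [0]. *)
Lemma metric_proj_nearest (q : Q) :
  K (metric_proj K q) /\ forall r, K r -> `|q - metric_proj K q| <= `|q - r|.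
Proof.
rewrite /metric_proj; case: xgetP => [p -> //|noP].
have [|p Kp hp] := exists_nearest q K0 Kcl; last by case: (noP p).
move=> u v Ku Kv; have := @convex_segment u v 2^-1 Ku Kv.
rewrite invr_ge0 invf_le1 ?ler1n ?ler0n //= => /(_ isT); congr K.
have {1}-> : u = 2^-1 *: u + 2^-1 *: u.
  by rewrite -scalerDl (_ : 2^-1 + 2^-1 = 1) ?scale1r //; field.
by rewrite scalerBr scalerDr addrACA subrr addr0.
Qed.

(** Sum of the variational inequalities at [q1] and [q2], each tested with the projection of the
    other point. *)
Lemma metric_proj_monotone (q1 q2 : Q) :
  `|metric_proj K q1 - metric_proj K q2| ^+ 2
    <= '(q1 - q2, metric_proj K q1 - metric_proj K q2).
Proof.
have vi q k : K k -> '(q - metric_proj K q, k - metric_proj K q) <= 0.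
  move=> Kk; apply: minimizer_variational_ineq => t t01.
  have [Kp] := metric_proj_nearest q.
  by apply; exact: convex_segment.
have [[K1 _] [K2 _]] := (metric_proj_nearest q1, metric_proj_nearest q2).
have := vi q1 _ K2; have := vi q2 _ K1.
move: (metric_proj K q1) (metric_proj K q2) => p1 p2.
rewrite sqr_normE !innerE (innerC p2 p1); lra.
Qed.

End MetricProjection.

(** * Functionals and the Riesz adjoint of [C] *)

Section Duality.
Context {R : realType}.

Lemma dual_scalar (V : normedModType R) (F : dual V) : scalar F.
Proof. by case: F => F /= /asboolP[]. Qed.

Lemma dualZ (V : normedModType R) (F : dual V) a v : F (a *: v) = a * F v.
Proof.
have F0 : F 0 = 0.
  by have := dual_scalar F (-1) 0 0; rewrite scaler0 addr0 mulN1r addNr.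
by rewrite -[a *: v]addr0 dual_scalar F0 addr0.
Qed.

Lemma dualD (V : normedModType R) (F : dual V) u v : F (u + v) = F u + F v.
Proof. by rewrite -[u in LHS]scale1r dual_scalar mul1r. Qed.

Lemma dualN (V : normedModType R) (F : dual V) v : F (- v) = - F v.
Proof. by rewrite -scaleN1r dualZ mulN1r. Qed.

Lemma dual_normP (V : normedModType R) (F : dual V) (c : R) :
  (dual_norm (fun v : V => `|v|%R) F <= c%:E)%E -> forall v, `|F v| <= c * `|v|.
Proof.
move=> hc v.
have [->|v0] := eqVneq v 0.
  by rewrite -(scale0r 0) dualZ mul0r !normr0 scale0r normr0 mulr0.
have nv : 0 < `|v| by rewrite normr_gt0.
have : (`|F (`|v|^-1 *: v)|%:E <= c%:E)%E.
  apply: le_trans hc; apply: ereal_sup_ubound; exists (`|v|^-1 *: v) => //=.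
  by rewrite normrZ normfV normr_id mulVf // gt_eqF.
by rewrite lee_fin dualZ normrM normfV normr_id ler_pdivrMl // mulrC.
Qed.

(** By [riesz] the set searched by [xget] in [adjC] is nonempty. *)
Lemma adjCE (V2 Q : hilbertType R) (C : {linear Q -> dual V2}) (M_C : R) :
  (forall q v, `|C q v| <= M_C * `|q| * `|v|) ->
  forall q v, '(q, adjC C v) = C q v.
Proof.
move=> hC q v; rewrite /adjC; case: xgetP => [p -> //|noP].
have [||p hp] := @riesz R Q (fun q => C q v) (M_C * `|v|).
- by move=> a q1 q2; rewrite linearP.
- by move=> q'; rewrite mulrAC.
- by case: (noP p).
Qed.

End Duality.

(** * Inf-sup condition and its transpose *)

Section BoundedBelow.
Context {R : realType} {V1 V2 : hilbertType R} (a : V1 -> V2 -> R) (M m : R).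
Hypotheses (al : forall v, scalar (a^~ v)) (ar : forall u, scalar (a u)).
Hypotheses (M0 : 0 <= M) (m0 : 0 < m).
Hypothesis (aM : forall u v, `|a u v| <= M * `|u| * `|v|).
Hypothesis (am : forall v c,
  0 <= c -> (forall u, a u v <= c * `|u|) -> m * `|v| <= c).

(** [T] is the adjoint of the form, with values in [V1] through Riesz representatives. The inf-sup
    hypothesis [am], taken at [c = |T v|], says that [T] is bounded below. *)
Lemma adjoint_riesz :
  exists T : {linear V2 -> V1},
    [/\ forall u v, '(u, T v) = a u v, forall v, m * `|v| <= `|T v| &
        continuous T].
Proof.
have /choice[T hT] : forall v, exists p, forall u, '(u, p) = a u v.
  move=> v; apply: (@riesz R V1 (a^~ v) (M * `|v|)) => // u.
  by rewrite mulrAC.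
have linT : linear T.
  move=> c u v; apply: inner_inj => w.
  by rewrite innerDr innerZr !hT ar.
pose T' : {linear V2 -> V1} := HB.pack T (GRing.isLinear.Build _ _ _ _ T linT).
exists T'; split => // [v|].
  apply: am => // u; rewrite -hT mulrC.
  by apply: le_trans (ler_norm _) _; exact: cauchy_schwarz.
apply: (@bounded_linear_is_continuous _ _ _ T M linT) => v.
have [->|Tv0] := eqVneq (T v) 0.
  by rewrite normr0 mulr_ge0.
have : 0 < `|T v| by rewrite normr_gt0.
move=> h; rewrite -(ler_pM2l h) -expr2 sqr_normE hT.
by rewrite (le_trans (ler_norm _)) // mulrA (mulrC `|T v|).
Qed.

(** As [T] is bounded below, some [T p] is nearest to [g] in its range. Then [g - T p] is orthogonal
    to the range, so [a (g - T p)] vanishes and injectivity gives [g = T p]. This is the transposed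
    inf-sup condition, with the same constant [m]. *)
Lemma adjoint_onto :
  (forall u, (forall v, a u v = 0) -> u = 0) ->
  forall g, exists v, (forall u, a u v = '(u, g)) /\ m * `|v| <= `|g|.
Proof.
move=> inj g; have [T [hT Tm cT]] := adjoint_riesz.
have [||||p _ hp] := @exists_minimizer R V2 V1 T m^-1 setT g _ _ cT _ closedT.
- by rewrite invr_gt0.
- by move=> v; rewrite ler_pdivlMl.
- by exists 0.
- by [].
have half k : '(g - T p, T k) <= 0.
  have -> : T k = T (p + k) - T p by rewrite linearD addrAC subrr add0r.
  apply: minimizer_variational_ineq => t _.
  by rewrite -linearB -linearZ -linearD; exact: hp.
have gTp : g = T p.
  apply/subr0_eq/inj => v; apply/eqP; rewrite -hT eq_le half /=.
  by rewrite -oppr_le0 -innerNr -[- T v]linearN half.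
by exists p; rewrite [in _ <= _]gTp; split => // u; rewrite gTp hT.
Qed.

(** Since [a (T e) e = |T e| ^+ 2], rescaling [T e] gives the value [|e| ^+ 2]; the norm becomes
    [|e| ^+ 2 / |T e|], at most [|e| / m]. *)
Lemma exists_test_function (e : V2) :
  exists u, a u e = `|e| ^+ 2 /\ m * `|u| <= `|e|.
Proof.
have [T [hT Tm _]] := adjoint_riesz.
have [->|e0] := eqVneq e 0.
  exists 0; rewrite !normr0 mulr0 expr0n /=; split => //.
  by rewrite -hT -(scale0r 0) innerZl mul0r.
have ne : 0 < `|e| by rewrite normr_gt0.
have nT : 0 < `|T e| by apply: lt_le_trans (Tm e); rewrite mulr_gt0.
exists ((`|e| / `|T e|) ^+ 2 *: T e); split.
  rewrite -hT innerZl -sqr_normE; field; rewrite gt_eqF //.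
rewrite normrZ ger0_norm ?sqr_ge0 //.
have -> : m * ((`|e| / `|T e|) ^+ 2 * `|T e|) = (m * `|e|) * `|e| / `|T e|.
  by field; rewrite gt_eqF.
by rewrite ler_pdivrMr // mulrC ler_pM2l.
Qed.

End BoundedBelow.

(** * Constants of the form, and the factor [kappa] *)

Section Forms.
Context {R : realType} {V1 V2 : normedModType R} (A : {linear V1 -> dual V2}).

Lemma form_scalarl (v : V2) : scalar (fun u => A u v).
Proof. by move=> c u1 u2; rewrite linearP. Qed.

Let AZl c u v : A (c *: u) v = c * A u v.
Proof. by rewrite linearZ. Qed.

Lemma form_sup_bound : (form_sup A < +oo)%E ->
  forall u v, `|A u v| <= fine (form_sup A) * `|u| * `|v|.
Proof.
move=> Mfin u v.
have [->|u0] := eqVneq u 0.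
  by rewrite -(scale0r 0) AZl mul0r !normr0 scale0r normr0 mulr0 mul0r.
have [->|v0] := eqVneq v 0.
  by rewrite -(scale0r 0) dualZ mul0r !normr0 scale0r normr0 mulr0.
have nv : 0 < `|v| by rewrite normr_gt0.
have bnd w : w != 0 -> A w v <= fine (form_sup A) * `|w| * `|v|.
  move=> w0; have nw : 0 < `|w| by rewrite normr_gt0.
  have unit (V : normedModType R) (z : V) : 0 < `|z| -> `| `|z|^-1 *: z| = 1.
    by move=> z0; rewrite normrZ normfV normr_id mulVf // gt_eqF.
  have le : ((A (`|w|^-1 *: w) (`|v|^-1 *: v))%:E <= form_sup A)%E.
    apply: le_ereal_sup_tmp; exists (ereal_sup
        [set (A (`|w|^-1 *: w) v2)%:E | v2 in [set v2 | `|v2| = 1]]).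
      by exists (`|w|^-1 *: w) => //=; exact: unit.
    by apply: ereal_sup_ubound; exists (`|v|^-1 *: v) => //=; exact: unit.
  (* [le] bounds the supremum below by a real number, which excludes [-oo]. *)
  have fin : form_sup A \is a fin_num.
    by rewrite fin_numE -ltey Mfin andbT -ltNye (lt_le_trans _ le) // ltNyr.
  move: le; rewrite -[X in (_ <= X)%E -> _](fineK fin) lee_fin AZl dualZ.
  by rewrite ler_pdivrMl // ler_pdivrMl // => /le_trans; apply; lra.
(* The supremum is over signed values; the lower bound comes from [- u]. *)
rewrite ler_norml bnd // andbT lerNl.
by have := bnd (- u); rewrite -scaleN1r AZl mulN1r scaleN1r normrN oppr_eq0 => ->.
Qed.

(** The normalized [v] competes in the infimum, and its inner supremum is at most [c / |v|]. This
    gives both the finiteness of [form_infsup] and the inf-sup estimate. *)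
Lemma form_infsup_le v c : v != 0 -> 0 <= c ->
  (forall u, A u v <= c * `|u|) -> (form_infsup A <= (c / `|v|)%:E)%E.
Proof.
move=> v0 c0 hc; have nv : 0 < `|v| by rewrite normr_gt0.
apply: ge_ereal_inf; exists (ereal_sup
    [set (A v1 (`|v|^-1 *: v))%:E | v1 in [set v1 | `|v1| = 1]]).
  exists (`|v|^-1 *: v) => //=.
  by rewrite normrZ normfV normr_id mulVf // gt_eqF.
apply: ge_ereal_sup => _ [u /= u1 <-]; rewrite lee_fin dualZ mulrC.
by rewrite ler_pM2r ?invr_gt0 // (le_trans (hc u)) // u1 mulr1.
Qed.

Hypothesis infsup_gt0 : (0 < form_infsup A)%E.

Lemma form_infsup_fin_num v c : v != 0 -> 0 <= c ->
  (forall u, A u v <= c * `|u|) -> form_infsup A \is a fin_num.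
Proof.
move=> v0 c0 hc; rewrite ge0_fin_numE ?(ltW infsup_gt0) //.
exact: le_lt_trans (form_infsup_le v0 c0 hc) (ltry _).
Qed.

Lemma form_infsup_bound v c : 0 <= c -> (forall u, A u v <= c * `|u|) ->
  fine (form_infsup A) * `|v| <= c.
Proof.
move=> c0 hc; have [->|v0] := eqVneq v 0; first by rewrite normr0 mulr0.
rewrite -ler_pdivlMr ?normr_gt0 // -lee_fin fineK.
  exact: form_infsup_le.
exact: form_infsup_fin_num hc.
Qed.

End Forms.

(** Applied with [m = M / ma] and [y = M * D / r]. As [y ^+ 2 / (1 + y)] increases with [y], it is
    enough to compare its value at [h], where the right-hand side is [1 + 2 * h], with [L * m]. *)
Lemma kappa_quadratic (R : realType) (L m y : R) :
  0 <= L -> 0 <= m -> 0 <= y -> y ^+ 2 <= L * m * (1 + y) ->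
  1 + 2 * y <= (1 + 2 * L) / (1 + L) * (1 + m * (1 + 2 * L)).
Proof.
move=> L0 m0 y0 hy; have L1 : 0 < 1 + L by lra.
rewrite mulrAC ler_pdivlMr //.
set q := m * (1 + 2 * L) ^+ 2.
have -> : (1 + 2 * L) * (1 + m * (1 + 2 * L)) = (1 + L) + (L + q).
  by rewrite /q; ring.
have q0 : 0 <= q by rewrite mulr_ge0 // sqr_ge0.
rewrite leNgt; apply/negP => hlt.
(* [1 + 2 * h] is the right-hand side; [hh] places [h] beyond the positive
   root of [y ^+ 2 = L * m * (1 + y)]. *)
set h := (L + q) / (2 * (1 + L)).
have hE : h * (2 * (1 + L)) = L + q by rewrite divfK // gt_eqF // mulr_gt0.
have h0 : 0 <= h by rewrite divr_ge0 ?addr_ge0 // mulr_ge0 // ltW.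
have hy' : h < y by rewrite ltr_pdivrMr ?mulr_gt0 //; lra.
have Lm0 : 0 <= L * m by rewrite mulr_ge0.
have hh : L * m * (1 + h) <= h ^+ 2.
  (* This factor clears the denominators of [h] and of [m = q / (1 + 2 * L) ^+ 2]; the difference is
     then a polynomial in [L] and [q] written as a sum of nonnegative terms. *)
  have p : 0 < (2 * (1 + L) * (1 + 2 * L)) ^+ 2.
    by rewrite exprn_gt0 // !mulr_gt0 //; lra.
  rewrite -(ler_pM2l p).
  have -> : (2 * (1 + L) * (1 + 2 * L)) ^+ 2 * h ^+ 2
      = ((1 + 2 * L) * (L + q)) ^+ 2 by rewrite -hE; ring.
  have -> : (2 * (1 + L) * (1 + 2 * L)) ^+ 2 * (L * m * (1 + h))
      = L * q * (2 * (1 + L)) * (2 * (1 + L) + (L + q)).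
    by rewrite -hE /q; ring.
  rewrite -subr_ge0.
  have -> : ((1 + 2 * L) * (L + q)) ^+ 2
        - L * q * (2 * (1 + L)) * (2 * (1 + L) + (L + q))
      = (L - q) ^+ 2 + L * (3 * L ^+ 2 + (L - q) ^+ 2 + q ^+ 2)
        + 4 * L ^+ 4 + 2 * (L * q) ^+ 2 + 2 * L ^+ 3 * q by ring.
  by rewrite !addr_ge0 ?sqr_ge0 ?mulr_ge0 ?addr_ge0 ?sqr_ge0 ?exprn_ge0
    ?mulr_ge0 ?sqr_ge0 ?exprn_ge0.
have h1 : 0 < 1 + h by lra.
have y1 : 0 < 1 + y by lra.
have : (1 + h) * y ^+ 2 <= (1 + y) * h ^+ 2.
  apply: (@le_trans _ _ ((1 + h) * (L * m * (1 + y)))); first by rewrite ler_pM2l.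
  have -> : (1 + h) * (L * m * (1 + y)) = (1 + y) * (L * m * (1 + h)) by ring.
  by rewrite ler_pM2l.
rewrite -subr_ge0.
have -> : (1 + y) * h ^+ 2 - (1 + h) * y ^+ 2 = (h - y) * (h + y + h * y) by ring.
have hy0 : 0 <= h * y by rewrite mulr_ge0.
by rewrite nmulr_rge0 ?subr_lt0 // leNgt; case/negP; lra.
Qed.

(** Times [ma], the left side is at most [r + 2 * (M * D)], that is [(1 + 2 * y) * r] with
    [y = M * D / r]. Inserting the bound on [E] into that on [D ^+ 2] gives the quadratic inequality
    for [y]. *)
Lemma kappa_bound (R : realType) (M ma alpha E D r : R) :
  0 <= M -> 0 < ma -> 0 < alpha -> 0 <= E -> 0 <= D -> 0 <= r ->
  ma * E <= r + M * D -> D ^+ 2 <= (Num.sqrt alpha)^-1 * r * E ->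
  E + M / ma * D <= kappa M ma alpha / ma * r.
Proof.
move=> M0 ma0 alpha0 E0 D0 r0 hE hD.
have s0 : 0 < (Num.sqrt alpha)^-1 by rewrite invr_gt0 sqrtr_gt0.
rewrite -(ler_pM2l ma0) (_ : ma * (_ / ma * r) = kappa M ma alpha * r); last first.
  by field; rewrite gt_eqF.
rewrite (_ : ma * (E + M / ma * D) = ma * E + M * D); last first.
  by field; rewrite gt_eqF.
apply: (@le_trans _ _ (r + 2 * (M * D))); first by lra.
(* For [r = 0] the bound on [D ^+ 2] forces [D = 0]. *)
have [r_eq0|rn0] := eqVneq r 0.
  move: hD; rewrite r_eq0 mulr0 mul0r exprn_even_le0 //= => /eqP ->.
  by rewrite !mulr0 add0r.
have rp : 0 < r by rewrite lt_def rn0.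
have -> : r + 2 * (M * D) = (1 + 2 * (M * D / r)) * r.
  by field.
rewrite ler_pM2r // /kappa; apply: kappa_quadratic.
- by rewrite mulr_ge0 // ltW.
- by rewrite divr_ge0 // ltW.
- by rewrite divr_ge0 // mulr_ge0.
move: hD s0; set s := (Num.sqrt alpha)^-1 => hD s0.
rewrite -(ler_pM2r (exprn_gt0 2 rp)) -(ler_pM2l ma0).
have -> : ma * ((M * D / r) ^+ 2 * r ^+ 2) = ma * M ^+ 2 * D ^+ 2.
  by field.
have -> : ma * (M * s * (M / ma) * (1 + M * D / r) * r ^+ 2)
    = M ^+ 2 * s * r * (r + M * D) by field; rewrite rn0 gt_eqF.
apply: (@le_trans _ _ (M ^+ 2 * (s * r * (ma * E)))).
  have -> : M ^+ 2 * (s * r * (ma * E)) = ma * M ^+ 2 * (s * r * E) by ring.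
  by rewrite ler_wpM2l // mulr_ge0 ?sqr_ge0 // ltW.
rewrite -!mulrA !ler_wpM2l ?sqr_ge0 // ?(ltW s0) //.
Qed.

(** * Error functional *)

Section ProductNorm.
Context {R : realType}.

Lemma cauchy_schwarz2 (a b c d : R) :
  a * c + b * d <= Num.sqrt (a ^+ 2 + b ^+ 2) * Num.sqrt (c ^+ 2 + d ^+ 2).
Proof.
rewrite -sqrtrM ?addr_ge0 ?sqr_ge0 //; apply: le_trans (ler_norm _) _.
rewrite -sqrtr_sqr ler_wsqrtr // -subr_ge0.
by rewrite (_ : _ - _ = (a * d - b * c) ^+ 2) ?sqr_ge0 //; ring.
Qed.

Context {V1 V2 : normedModType R}.
Implicit Types v : V1 * V2.

Lemma sqr_prod_norm v : prod_norm v ^+ 2 = `|v.1| ^+ 2 + `|v.2| ^+ 2.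
Proof. by rewrite sqr_sqrtr // addr_ge0 ?sqr_ge0. Qed.

Lemma prod_norm_ge0 v : 0 <= prod_norm v.
Proof. exact: sqrtr_ge0. Qed.

Lemma prod_normZ a v : prod_norm (a *: v) = `|a| * prod_norm v.
Proof.
rewrite /prod_norm /= !normrZ !exprMn -mulrDr sqrtrM ?sqr_ge0 //.
by rewrite sqrtr_sqr normr_id.
Qed.

Lemma prod_norm_eq0 v : prod_norm v = 0 -> v = 0.
Proof.
move=> v0; have := sqr_prod_norm v; rewrite v0 expr0n /= => /esym/eqP.
rewrite paddr_eq0 ?sqr_ge0 // !sqrf_eq0 !normr_eq0 => /andP[/eqP + /eqP].
by case: v {v0} => ? ? /= -> ->.
Qed.

Lemma dual_prod_norm_bound (F : V1 * V2 -> R) :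
  (forall a v, F (a *: v) = a * F v) -> (dual_norm prod_norm F < +oo)%E ->
  forall v, `|F v| <= fine (dual_norm prod_norm F) * prod_norm v.
Proof.
move=> FZ Ffin v.
have [/prod_norm_eq0 ->|v0] := eqVneq (prod_norm v) 0.
  by rewrite -(scale0r (0 : V1 * V2)) FZ prod_normZ !(mul0r, normr0, mulr0).
have nv : 0 < prod_norm v by rewrite lt_def v0 prod_norm_ge0.
have le : (`|F ((prod_norm v)^-1 *: v)|%:E <= dual_norm prod_norm F)%E.
  apply: ereal_sup_ubound; exists ((prod_norm v)^-1 *: v) => //=.
  by rewrite prod_normZ ger0_norm ?invr_ge0 ?(ltW nv) // mulVf.
have fin : dual_norm prod_norm F \is a fin_num.
  by rewrite ge0_fin_numE // (le_trans _ le) // lee_fin.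
move: le; rewrite -[X in (_ <= X)%E -> _](fineK fin) lee_fin FZ normrM.
by rewrite ger0_norm ?invr_ge0 ?(ltW nv) // ler_pdivrMl // mulrC.
Qed.

Lemma dual_prod_norm_le (F : V1 * V2 -> R) c : 0 <= c ->
  (forall v, `|F v| <= c * prod_norm v) -> (dual_norm prod_norm F <= c%:E)%E.
Proof.
move=> c0 hF; apply: ge_ereal_sup => _ [v /= v1 <-]; rewrite lee_fin.
by apply: le_trans (hF v) _; rewrite ler_piMr.
Qed.

End ProductNorm.

Section ErrorBounds.
Context {R : realType} {V1 V2 Q W : hilbertType R}.
Variables (A : {linear V1 -> dual V2}) (C : {linear Q -> dual V2}).
Variables (I : {linear V1 -> W}) (M Ma ma alpha : R) (e : V1 * V2) (dq : Q).
Hypotheses (M0 : 0 <= M) (Ma0 : 0 <= Ma) (alpha0 : 0 < alpha).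
Hypotheses (hC : forall q v, `|C q v| <= M * `|q| * `|v|).
Hypotheses (hI : forall v, `|I v| <= M * `|v|).
Hypotheses (hA : forall u v, `|A u v| <= Ma * `|u| * `|v|).

Let s := (Num.sqrt alpha)^-1.
Let D := s * Num.sqrt (alpha * `|dq| ^+ 2 + `|I e.1| ^+ 2).

Definition error_functional (phi : V1 * V2) : R :=
  A e.1 phi.2 + A phi.1 e.2 - C dq phi.2 - s * '(I e.1, I phi.1).

Let s0 : 0 < s. Proof. by rewrite invr_gt0 sqrtr_gt0. Qed.

(** Because [s ^+ 2 * alpha = 1], [D] is the Euclidean length of a pair, the form in which
    [cauchy_schwarz2] yields it. *)
Let D_sqr : D ^+ 2 = `|dq| ^+ 2 + (s * `|I e.1|) ^+ 2.
Proof.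
have sa : s ^+ 2 * alpha = 1.
  by rewrite exprVn sqr_sqrtr ?mulVf ?gt_eqF // ltW.
rewrite exprMn sqr_sqrtr ?addr_ge0 ?mulr_ge0 ?sqr_ge0 ?(ltW alpha0) //.
by rewrite mulrDr mulrA sa mul1r exprMn.
Qed.

Let D_ge0 : 0 <= D. Proof. by rewrite mulr_ge0 ?sqrtr_ge0 ?(ltW s0). Qed.

Let coupling phi :
  `|C dq phi.2 + s * '(I e.1, I phi.1)| <= M * D * prod_norm phi.
Proof.
apply: (@le_trans _ _ (M * (`|dq| * `|phi.2| + s * `|I e.1| * `|phi.1|))).
  rewrite mulrDr (le_trans (ler_normD _ _)) // lerD //.
    by rewrite mulrA.
  rewrite normrM (ger0_norm (ltW s0)) -mulrA mulrCA ler_wpM2l ?(ltW s0) //.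
  apply: le_trans (cauchy_schwarz _ _) _.
  by rewrite mulrCA ler_wpM2l.
rewrite -[M * D * _]mulrA ler_wpM2l //; apply: le_trans (cauchy_schwarz2 _ _ _ _) _.
rewrite -D_sqr sqrtr_sqr ger0_norm // ler_wpM2l //.
by rewrite addrC.
Qed.

Lemma error_functional_le phi :
  `|error_functional phi| <= (Ma * prod_norm e + M * D) * prod_norm phi.
Proof.
rewrite /error_functional -addrA -opprD mulrDl.
apply: le_trans (ler_normB _ _) _; apply: lerD; last exact: coupling.
apply: (@le_trans _ _ (Ma * (`|e.1| * `|phi.2| + `|e.2| * `|phi.1|))).
  apply: le_trans (ler_normD _ _) _; rewrite mulrDr lerD //.
    by rewrite mulrA.
  by rewrite (mulrC `|e.2|) mulrA.
rewrite -mulrA ler_wpM2l //; apply: le_trans (cauchy_schwarz2 _ _ _ _) _.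
by rewrite ler_wpM2l ?sqrtr_ge0 // addrC.
Qed.

Variable r : R.
Hypothesis hr : forall phi, `|error_functional phi| <= r * prod_norm phi.

(** On [phi] the [A] terms sum to [prod_norm e ^+ 2], while [prod_norm phi] is at most
    [prod_norm e / ma]; the other terms are absorbed by [coupling]. *)
Lemma error_le_residual (phi : V1 * V2) : 0 < ma -> 0 <= r ->
  A e.1 phi.2 = `|e.1| ^+ 2 -> A phi.1 e.2 = `|e.2| ^+ 2 ->
  ma * `|phi.1| <= `|e.2| -> ma * `|phi.2| <= `|e.1| ->
  ma * prod_norm e <= r + M * D.
Proof.
move=> ma0 r0 A1 A2 p1 p2; have [e0|e0] := eqVneq (prod_norm e) 0.
  by rewrite e0 mulr0 addr_ge0 // mulr_ge0.
have ep : 0 < prod_norm e by rewrite lt_def e0 prod_norm_ge0.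
have : ma * prod_norm phi <= prod_norm e.
  rewrite -ler_sqr ?nnegrE ?mulr_ge0 ?prod_norm_ge0 ?(ltW ma0) //.
  rewrite exprMn !sqr_prod_norm mulrDr -!exprMn [leRHS]addrC.
  by rewrite lerD // ler_sqr ?nnegrE // mulr_ge0 // ltW.
have eE : prod_norm e ^+ 2
    = error_functional phi + (C dq phi.2 + s * '(I e.1, I phi.1)).
  by rewrite sqr_prod_norm -A1 -A2 /error_functional; ring.
have : prod_norm e ^+ 2 <= (r + M * D) * prod_norm phi.
  rewrite eE mulrDl; apply: lerD; apply: le_trans (ler_norm _) _.
    exact: hr.
  exact: coupling.
rewrite -(ler_pM2l ma0) => h1 h2.
rewrite -(ler_pM2r ep) -mulrA -expr2 (le_trans h1) // mulrCA.
by rewrite ler_wpM2l // addr_ge0 // mulr_ge0.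
Qed.

(** At [(e.1, - e.2)] only [C dq e.2 - s * |I e.1| ^+ 2] remains, and the hypothesis makes both
    terms nonpositive. Scaling by [s] recovers [D ^+ 2]. *)
Lemma control_error_le_residual :
  Num.sqrt alpha * `|dq| ^+ 2 <= - C dq e.2 ->
  D ^+ 2 <= s * r * prod_norm e.
Proof.
move=> hdq; have := hr (e.1, - e.2).
rewrite /error_functional /= !dualN addNr sub0r opprK.
rewrite [prod_norm _](_ : _ = prod_norm e); last by rewrite /prod_norm /= normrN.
rewrite -sqr_normE ler_norml => /andP[h _].
have <- : s * (Num.sqrt alpha * `|dq| ^+ 2 + s * `|I e.1| ^+ 2) = D ^+ 2.
  have sa : s * Num.sqrt alpha = 1 by rewrite mulVf // gt_eqF // sqrtr_gt0.
  by rewrite D_sqr mulrDr [s * (_ * `|dq| ^+ 2)]mulrA sa; ring.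
by rewrite -[s * r * _]mulrA ler_pM2l //; lra.
Qed.

End ErrorBounds.

(** * Residual and control in terms of the error *)

Section ResidualEquation.
Context {R : realType} {V1 V2 Q W : hilbertType R}.
Variables (A : {linear V1 -> dual V2}) (C : {linear Q -> dual V2}).
Variables (I : {linear V1 -> W}) (K : set Q) (M alpha : R).
Hypothesis hC : forall q v, `|C q v| <= M * `|q| * `|v|.

(** The equation for [x] eliminates the data [f] and [u_d], and [adjCE] turns the inner product with
    [adjC] into a pairing with [C]. *)
Lemma residual_error (f : dual V2) (u_d : W) (x xt : V1 * V2) :
  (forall phi, b_alpha A C I K alpha x phi =
     f phi.2 - (Num.sqrt alpha)^-1 * '(u_d, I phi.1)) ->
  residual A C I K alpha f u_d xt =
  error_functional A C I alpha (x - xt)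
    (control C K alpha x.2 - control C K alpha xt.2).
Proof.
move=> hx; apply/funext => phi; have := hx phi.
rewrite /b_alpha (adjCE hC) /error_functional /= => hphi.
have -> : residual A C I K alpha f u_d xt phi =
    f phi.2 - A xt.1 phi.2 + C (control C K alpha xt.2) phi.2
    + ((Num.sqrt alpha)^-1 * '(I phi.1, I xt.1 - u_d) - A phi.1 xt.2) by [].
rewrite !linearB /= dualD dualN innerDl innerNl (innerC (I phi.1)).
rewrite (innerC (I phi.1) u_d) [X in _ = X + _ + _ - _](_ : _ =
  A x.1 phi.2 - A xt.1 phi.2) //.
move: hphi; lra.
Qed.

(** [metric_proj_monotone] at the two rescaled adjoint states; [adjCE] moves [adjC] over to [C], and
    the factor [- (Num.sqrt alpha)^-1] supplies the sign. *)
Lemma control_error_monotone (v w : V2) : 0 < alpha ->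
  K !=set0 -> closed K -> convex_set (K : set (convex_lmodType Q)) ->
  Num.sqrt alpha * `|control C K alpha v - control C K alpha w| ^+ 2
    <= - C (control C K alpha v - control C K alpha w) (v - w).
Proof.
move=> alpha0 K0 Kcl Kconv; set dq := control C K alpha v - _.
have sa : 0 < Num.sqrt alpha by rewrite sqrtr_gt0.
have := metric_proj_monotone K0 Kcl Kconv
  (- (Num.sqrt alpha)^-1 *: adjC C v) (- (Num.sqrt alpha)^-1 *: adjC C w).
rewrite -/(control C K alpha v) -/(control C K alpha w) -/dq.
rewrite -scalerBr innerZl innerC innerDr innerNr !(adjCE hC).
have sE (z : R) : Num.sqrt alpha * (- (Num.sqrt alpha)^-1 * z) = - z.
  by field; rewrite gt_eqF.
by rewrite dualD dualN => h; rewrite -sE ler_pM2l.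
Qed.

End ResidualEquation.

(** * The two-sided residual estimate *)

Theorem theorem3p1 (R : realType) (V1 V2 Q W : hilbertType R)
  (A : {linear V1 -> dual V2})
  (hMa : (form_sup A < +oo)%E)
  (hA : forall v1 : V1, (forall v2 : V2, A v1 v2 = 0) -> v1 = 0)
  (hma : (0 < form_infsup A)%E)
  (C : {linear Q -> dual V2}) (M_C : R)
  (hC : forall q : Q,
    (dual_norm (fun v : V2 => `|v|%R) (C q) <= (M_C * `|q|)%:E)%E)
  (I : {linear V1 -> W}) (M_I : R)
  (hI : forall v : V1, `|I v| <= M_I * `|v|)
  (f : dual V2) (u_d : W) (alpha : R) (halpha : 0 < alpha)
  (K : set Q) (hK0 : K !=set0) (hKclosed : closed K)
  (hKconvex : convex_set (K : set (convex_lmodType Q)))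
  (x : V1 * V2)
  (hx : forall phi : V1 * V2,
    b_alpha A C I K alpha x phi =
      f phi.2 - (Num.sqrt alpha)^-1 * '(u_d, I phi.1))
  (xt : V1 * V2) :
  let M := Num.max M_I M_C in
  let Ma := fine (form_sup A) in
  let ma := fine (form_infsup A) in
  let res_norm := dual_norm prod_norm (residual A C I K alpha f u_d xt) in
  (Ma^-1%:E * res_norm <= (d_alpha C I K alpha M Ma x xt)%:E)%E /\
  ((d_alpha C I K alpha M Ma x xt)%:E <= (kappa M ma alpha / ma)%:E * res_norm)%E.
Proof.
move=> M Ma ma res_norm.
have hC' q v := dual_normP (hC q) v.
set e := x - xt; set dq := control C K alpha x.2 - control C K alpha xt.2.
have resE := residual_error hC' xt hx; rewrite -/e -/dq in resE.
have resZ a v : residual A C I K alpha f u_d xt (a *: v)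
    = a * residual A C I K alpha f u_d xt v.
  rewrite resE /error_functional /= [A (a *: _)]linearZ.
  rewrite [I (a *: _)]linearZ innerZr !dualZ /=.
  by rewrite [X in _ + X - _ - _](_ : _ = a * A v.1 e.2) //; ring.
have res0 : residual A C I K alpha f u_d xt 0 = 0.
  by rewrite -(scale0r (0 : V1 * V2)) resZ mul0r.
have res_ge0 : (0 <= res_norm)%E.
  apply: le_ereal_sup_tmp; exists `|residual A C I K alpha f u_d xt 0|%:E.
    by exists 0 => //=; rewrite -(scale0r (0 : V1 * V2)) prod_normZ normr0 mul0r.
  by rewrite lee_fin.
(* When [V2 = 0], also [V1 = 0], and [Ma = ma = 0] since [fine] sends the
   infinite bounds of the empty set to [0]. *)
have [v2_eq0|/existsNP[v2 /eqP v20]] := pselect (forall v : V2, v = 0).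
  have v1_eq0 (v : V1) : v = 0.
    by apply: hA => v2; rewrite (v2_eq0 v2) -(scale0r 0) dualZ mul0r.
  have v_eq0 (v : V1 * V2) : v = 0.
    by case: v => v w; rewrite (v1_eq0 v) (v2_eq0 w).
  have -> : res_norm = 0%E.
    apply/eqP; rewrite eq_le res_ge0 andbT; apply: dual_prod_norm_le => // v.
    by rewrite (v_eq0 v) res0 normr0 mul0r.
  have -> : d_alpha C I K alpha M Ma x xt = 0.
    rewrite /d_alpha /delta_alpha (v_eq0 x) (v_eq0 xt) !subrr /prod_norm /=.
    by rewrite linear0 !normr0 expr0n /= mulr0 addr0 sqrtr0 mulr0 addr0.
  by rewrite !mule0 lexx.
have Mge : M_I <= M /\ M_C <= M by rewrite /M !le_max !lexx orbT.
have hCM q v : `|C q v| <= M * `|q| * `|v|.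
  apply: le_trans (hC' q v) _.
  by rewrite -!mulrA ler_wpM2r ?mulr_ge0 //; case: Mge.
have hIM v : `|I v| <= M * `|v|.
  by apply: le_trans (hI v) _; rewrite ler_wpM2r //; case: Mge.
have hAM := form_sup_bound hMa; have hAm := form_infsup_bound hma.
rewrite -/Ma in hAM; rewrite -/ma in hAm.
have nv2 : 0 < `|v2| by rewrite normr_gt0.
(* The absolute value stays until a nonzero vector of [V1] shows [0 <= Ma]. *)
have maMa : ma <= `|Ma|.
  rewrite -(ler_pM2r nv2); apply: hAm; first by rewrite mulr_ge0.
  move=> u; rewrite mulrAC (le_trans (ler_norm _)) // (le_trans (hAM _ _)) //.
  by rewrite !ler_wpM2r // ler_norm.
have mafin : form_infsup A \is a fin_num.
  apply: (form_infsup_fin_num (c := `|Ma| * `|v2|) hma v20) => [|u].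
    by rewrite mulr_ge0.
  rewrite mulrAC (le_trans (ler_norm _)) // (le_trans (hAM _ _)) //.
  by rewrite !ler_wpM2r // ler_norm.
have ma0 : 0 < ma by rewrite fine_gt0 // hma -ge0_fin_numE // ltW.
(* If [V1] were trivial, the inf-sup bound at [v2] would hold with [c = 0]. The signs of [M] and
   [Ma] are then read off from the bounds at [v1] and [v2]. *)
have [v1 v10] : exists v1 : V1, v1 != 0.
  apply/not_existsP => v1_eq0.
  have : ma * `|v2| <= 0.
    apply: hAm => // u; have /negP := v1_eq0 u; rewrite negbK => /eqP ->.
    by rewrite linear0 mul0r.
  by rewrite leNgt mulr_gt0.
have nv1 : 0 < `|v1| by rewrite normr_gt0.
have M0 : 0 <= M by rewrite -(pmulr_lge0 _ nv1) (le_trans _ (hIM v1)).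
have Ma_ge0 : 0 <= Ma.
  by rewrite -(pmulr_lge0 _ nv1) -(pmulr_lge0 _ nv2) (le_trans _ (hAM v1 v2)).
rewrite ger0_norm // in maMa.
set D := (Num.sqrt alpha)^-1 * Num.sqrt (alpha * `|dq| ^+ 2 + `|I e.1| ^+ 2).
have D0 : 0 <= D by rewrite mulr_ge0 ?invr_ge0 ?sqrtr_ge0.
have dE : d_alpha C I K alpha M Ma x xt = prod_norm e + M / Ma * D.
  by rewrite /d_alpha -/e; congr (_ + _); rewrite -mulrA mulrCA.
have res_le : (res_norm <= (Ma * prod_norm e + M * D)%:E)%E.
  apply: dual_prod_norm_le.
    by rewrite addr_ge0 // mulr_ge0 // prod_norm_ge0.
  by move=> phi; rewrite resE; exact: error_functional_le.
have res_lty : (res_norm < +oo)%E by exact: le_lt_trans res_le (ltry _).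
have resK : (fine res_norm)%:E = res_norm by rewrite fineK // ge0_fin_numE.
have r0 : 0 <= fine res_norm by rewrite fine_ge0.
have Ma0 : 0 < Ma by exact: lt_le_trans maMa.
have hr phi : `|error_functional A C I alpha e dq phi|
    <= fine res_norm * prod_norm phi.
  by rewrite -resE; exact: dual_prod_norm_bound.
rewrite -resK -!EFinM !lee_fin dE; split.
  rewrite ler_pdivrMl // (_ : Ma * _ = Ma * prod_norm e + M * D).
    by rewrite -lee_fin resK.
  by field; rewrite gt_eqF.
(* The test pair is crossed: [phi2] solves the adjoint problem for [e.1], and [phi1] tests [e.2]. *)
have [phi2 [A1 p2]] :
    exists v, A e.1 v = `|e.1| ^+ 2 /\ ma * `|v| <= `|e.1|.
  have [v [hv pv]] := adjoint_onto (form_scalarl A) (fun u => dual_scalar (A u))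
    Ma_ge0 ma0 hAM hAm hA e.1.
  by exists v; rewrite hv sqr_normE.
have [phi1 [A2 p1]] := exists_test_function (form_scalarl A)
  (fun u => dual_scalar (A u)) Ma_ge0 ma0 hAM hAm e.2.
have hE := error_le_residual M0 halpha hCM hIM hr (phi := (phi1, phi2))
  ma0 r0 A1 A2 p1 p2.
have hD := control_error_le_residual halpha hr
  (control_error_monotone hCM x.2 xt.2 halpha hK0 hKclosed hKconvex).
(* [d_alpha] weights [D] by [M / Ma], which is at most [M / ma] as [ma <= Ma]. *)
apply: le_trans (kappa_bound M0 ma0 halpha (prod_norm_ge0 e) D0 r0 hE hD).
by rewrite lerD2l ler_wpM2r // ler_wpM2l // lef_pV2 // posrE.
Qed.
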